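(* For every $\mu>0$, the amplitude $A_{\text{van}}(\mu)$ of the unique limit cycle of the van der Pol equation $$\ddot x+\mu(x^2-1)\dot x+x=0$$ satisfies $A_{\text{van}}(\mu)>2$.
   Context: It is classical that for every $\mu>0$ the van der Pol equation, viewed in the phase plane as $\dot x=y$, $\dot y=-x-\mu(x^2-1)y$, has a unique limit cycle (a nonconstant periodic orbit, which is stable and attracts every non-equilibrium solution). The amplitude of a limit cycle is the maximum of $|x|$ along the orbit; $A_{\text{van}}(\mu)$ denotes the amplitude of this unique limit cycle. *)

(* Defs.v *)
From Stdlib Require Import Reals.
From Coquelicot Require Import Coquelicot.
Open Scope R_scope.

Definition vdp_solution (mu : R) (x y : R -> R) : Prop :=
  forall t : R,
    is_derive x t (y t) /\
    is_derive y t (- x t - mu * (x t ^ 2 - 1) * y t).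

Definition periodic_traj (x y : R -> R) : Prop :=
  exists T : R, 0 < T /\ forall t : R, x (t + T) = x t /\ y (t + T) = y t.

Definition nonconstant_traj (x y : R -> R) : Prop :=
  exists s t : R, (x s, y s) <> (x t, y t).

Definition is_orbit (x y : R -> R) (Gamma : R * R -> Prop) : Prop :=
  forall p : R * R, Gamma p <-> exists t : R, p = (x t, y t).

(* A limit cycle is taken to be a nonconstant periodic orbit.  For mu > 0 the
   van der Pol system has exactly one; its isolation, stability and global
   attractivity are classical consequences, not part of the definition. *)
Definition limit_cycle (mu : R) (Gamma : R * R -> Prop) : Prop :=
  exists x y : R -> R,
    vdp_solution mu x y /\ periodic_traj x y /\ nonconstant_traj x y /\
    is_orbit x y Gamma.

Definition is_amplitude (Gamma : R * R -> Prop) (A : R) : Prop :=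
  (exists p : R * R, Gamma p /\ Rabs (fst p) = A) /\
  (forall p : R * R, Gamma p -> Rabs (fst p) <= A).

(* Main.v *)
(** Suppose that the amplitude is at most 2.  Scaling it to 2 and reflecting if
    necessary gives a periodic solution of
      X' = Y,  Y' = -X - mu (l X^2 - 1) Y  with  l <= 1,
    which stays in |X| <= 2 and touches X = -2.

    For mu <= 9/2 put H = Y^2 - d(X) Y - q(X), where d is an explicit odd
    polynomial and q is determined by q(2) = 0 and
    q' = -2x - d (d' + mu (x^2 - 1)).  Then H' = -Lambda H + N with
    N >= 0 as soon as x d >= q (d' + 2 mu (x^2 - 1)) on |x| <= 2.  But H vanishes
    whenever the orbit touches X = -2, so N = 0 along the orbit, which is absurd.

    For mu >= 9/2 follow the arch Y > 0 from X = -2 with the Lienard coordinate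
    J = Y - mu (1+X)^2 (2-X) / 3, for which J' >= -X.  Near X = -1 the value of J
    becomes at least a constant times mu^(-1/3), while reaching Y = 0 with
    0 <= X <= 2 only allows a smaller multiple of mu^(-1/3). *)

Require Import Defs.
From Stdlib Require Import Reals Lra ZArith.
From Coquelicot Require Import Coquelicot.
Open Scope R_scope.

(** * First zeros, barriers and extrema of functions on the line *)

Lemma is_derive_continuity (f : R -> R) (t l : R) :
  is_derive f t l -> continuity_pt f t.
Proof.
  intros H. apply continuity_pt_filterlim, (@ex_derive_continuous _ _ f).
  exists l; exact H.
Qed.

(** The zero is the supremum of the times up to which [f] stays positive: by continuity [f c < 0]
    contradicts positivity just before [c], and [f c > 0] would let the supremum be pushed
    further. *)
Lemma first_zero (f : R -> R) (a b : R) :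
  (forall t, a <= t <= b -> continuity_pt f t) ->
  a <= b -> 0 < f a -> f b <= 0 ->
  exists c, a < c <= b /\ f c = 0 /\ forall t, a <= t < c -> 0 < f t.
Proof.
  intros Hc Hab Ha Hb.
  set (E := fun t => a <= t <= b /\ forall s, a <= s <= t -> 0 < f s).
  assert (HE : E a).
  { split; [lra|]. intros s Hs. replace s with a by lra. exact Ha. }
  destruct (completeness E) as [c [Hub Hlub]].
  { exists b. intros t [Ht _]. lra. }
  { exists a. exact HE. }
  assert (Hac : a <= c) by (apply Hub, HE).
  assert (Hcb : c <= b) by (apply Hlub; intros t [Ht _]; lra).
  assert (Hpos : forall t, a <= t < c -> 0 < f t).
  { intros t Ht.
    destruct (Rlt_or_le 0 (f t)) as [|Hneg]; [assumption|exfalso].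
    assert (c <= t); [|lra].
    apply Hlub. intros s [Hs Hs'].
    destruct (Rle_or_lt s t) as [|Hts]; [assumption|exfalso].
    specialize (Hs' t ltac:(lra)). lra. }
  assert (Hcont := Hc c (conj Hac Hcb)).
  assert (Hfc : f c = 0).
  { destruct (Rtotal_order (f c) 0) as [Hn|[He|Hp]]; [exfalso|exact He|exfalso].
    - destruct (Hcont (- f c) ltac:(lra)) as [del [Hdel Hd]].
      assert (a < c) by (destruct Hac as [ | <- ]; lra).
      set (s := Rmax a (c - del / 2)).
      assert (Hs : a <= s < c) by (unfold s, Rmax; destruct Rle_dec; lra).
      assert (Hs2 : c - s < del) by (unfold s, Rmax; destruct Rle_dec; lra).
      specialize (Hpos s Hs).
      specialize (Hd s). unfold D_x, no_cond, dist in Hd; simpl in Hd.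
      unfold Rdist in Hd.
      rewrite (Rabs_left (s - c)) in Hd by lra.
      assert (Hs3 := Hd ltac:(repeat split; lra)).
      apply Rabs_def2 in Hs3. lra.
    - assert (c < b) by (destruct Hcb as [ | -> ]; lra).
      destruct (Hcont (f c) Hp) as [del [Hdel Hd]].
      set (u := Rmin b (c + del / 2)).
      assert (Hu : c < u <= b) by (unfold u, Rmin; destruct Rle_dec; lra).
      assert (Hu2 : u - c < del) by (unfold u, Rmin; destruct Rle_dec; lra).
      assert (u <= c); [|lra].
      apply Hub. split; [lra|]. intros s Hs.
      destruct (Rlt_or_le s c) as [|Hsc]; [apply Hpos; lra|].
      destruct Hsc as [Hsc|<-]; [|exact Hp].
      specialize (Hd s). unfold D_x, no_cond, dist in Hd; simpl in Hd.
      unfold Rdist in Hd.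
      rewrite (Rabs_right (s - c)) in Hd by lra.
      assert (Hs3 := Hd ltac:(repeat split; lra)).
      apply Rabs_def2 in Hs3. lra. }
  exists c. split; [|split; assumption].
  destruct Hac as [ | <- ]; lra.
Qed.

Lemma derive_pos_right (f : R -> R) (t l : R) :
  is_derive f t l -> 0 < l ->
  exists del, 0 < del /\ forall s, t < s < t + del -> f t < f s.
Proof.
  intros H Hl. apply is_derive_Reals in H.
  destruct (H l Hl) as [del Hd].
  exists del. split; [apply cond_pos|]. intros s Hs.
  specialize (Hd (s - t) ltac:(lra)).
  rewrite Rabs_right in Hd by lra. specialize (Hd ltac:(lra)).
  replace (t + (s - t)) with s in Hd by ring.
  apply Rabs_def2 in Hd. destruct Hd as [_ Hd].
  assert (0 < (f s - f t) / (s - t)) by lra.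
  assert (0 < (f s - f t) / (s - t) * (s - t)) by (apply Rmult_lt_0_compat; lra).
  replace ((f s - f t) / (s - t) * (s - t)) with (f s - f t) in H1 by (field; lra).
  lra.
Qed.

Lemma derive_pos_left (f : R -> R) (t l : R) :
  is_derive f t l -> 0 < l ->
  exists del, 0 < del /\ forall s, t - del < s < t -> f s < f t.
Proof.
  intros H Hl.
  destruct (derive_pos_right (fun u => - f (- u)) (- t) l) as [del [Hdel Hd]].
  - evar_last.
    + apply (@is_derive_opp _ R_NormedModule), (is_derive_comp f Ropp).
      * rewrite Ropp_involutive. exact H.
      * apply (@is_derive_opp _ R_NormedModule), is_derive_id.
    + unfold opp, scal, one; simpl. unfold mult; simpl. ring.
  - exact Hl.
  - exists del. split; [exact Hdel|]. intros s Hs.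
    specialize (Hd (- s) ltac:(lra)). rewrite !Ropp_involutive in Hd. lra.
Qed.

Lemma derive_at_first_zero (f : R -> R) (a c l : R) :
  a < c -> is_derive f c l -> f c = 0 ->
  (forall t, a <= t < c -> 0 < f t) -> l <= 0.
Proof.
  intros Hac Hd Hc Hpos.
  destruct (Rle_or_lt l 0) as [|Hl]; [assumption|exfalso].
  destruct (derive_pos_left f c l Hd Hl) as [del [Hdel H]].
  set (s := Rmax a (c - del / 2)).
  assert (Hs : a <= s < c) by (unfold s, Rmax; destruct Rle_dec; lra).
  assert (Hs2 : c - del < s) by (unfold s, Rmax; destruct Rle_dec; lra).
  specialize (H s ltac:(lra)). specialize (Hpos s Hs). lra.
Qed.

(** At a first zero the derivative would be both nonpositive and positive. The sign of [f'] has to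
    be known only on the level set [f = 0], where a barrier equation can be substituted. *)
Lemma strict_barrier (f f' : R -> R) (a b : R) :
  (forall t, a <= t <= b -> is_derive f t (f' t)) ->
  0 < f a ->
  (forall t, a <= t <= b -> f t = 0 -> 0 < f' t) ->
  forall t, a <= t <= b -> 0 < f t.
Proof.
  intros Hd Ha Hb t Ht.
  destruct (Rlt_or_le 0 (f t)) as [|Hn]; [assumption|exfalso].
  destruct (first_zero f a t) as [c [Hc [Hfc Hpos]]].
  - intros s Hs. apply is_derive_continuity with (f' s), Hd. lra.
  - lra.
  - exact Ha.
  - exact Hn.
  - assert (f' c <= 0)
      by (apply (derive_at_first_zero f a c); auto; [lra|apply Hd; lra]).
    specialize (Hb c ltac:(lra) Hfc). lra.
Qed.

Lemma derive_nonneg_le (f f' : R -> R) (a b : R) :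
  a <= b -> (forall t, a <= t <= b -> is_derive f t (f' t)) ->
  (forall t, a <= t <= b -> 0 <= f' t) -> f a <= f b.
Proof.
  intros Hab Hd Hp.
  destruct (MVT_gen f a b f') as [c [Hc Heq]].
  - intros t Ht. rewrite Rmin_left, Rmax_right in Ht by lra. apply Hd; lra.
  - intros t Ht. rewrite Rmin_left, Rmax_right in Ht by lra.
    apply is_derive_continuity with (f' t), Hd; lra.
  - rewrite Rmin_left, Rmax_right in Hc by lra.
    assert (0 <= f' c * (b - a)) by (apply Rmult_le_pos; [apply Hp|]; lra). lra.
Qed.

Lemma derive_at_max (f : R -> R) (t l : R) :
  is_derive f t l -> (forall s, f s <= f t) -> l = 0.
Proof.
  intros Hd Hm. destruct (Rtotal_order l 0) as [Hn|[|Hp]]; [exfalso|assumption|exfalso].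
  - destruct (derive_pos_left (fun s => - f s) t (- l)) as [del [Hdel H]].
    + apply (@is_derive_opp _ R_NormedModule), Hd.
    + lra.
    + specialize (H (t - del / 2) ltac:(lra)). specialize (Hm (t - del / 2)). lra.
  - destruct (derive_pos_right f t l Hd Hp) as [del [Hdel H]].
    specialize (H (t + del / 2) ltac:(lra)). specialize (Hm (t + del / 2)). lra.
Qed.

Lemma derive_at_min (f : R -> R) (t l : R) :
  is_derive f t l -> (forall s, f t <= f s) -> l = 0.
Proof.
  intros Hd Hm. enough (- l = 0) by lra.
  apply (derive_at_max (fun s => - f s) t).
  - apply (@is_derive_opp _ R_NormedModule), Hd.
  - intros s. specialize (Hm s). lra.
Qed.

(** The equation of [X = c * x] for a solution [x] of the van der Pol equation, with [l = / c ^ 2].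
    When the extreme value of [|X|] is 2, [l <= 1] says that the amplitude of [x] is at most 2. *)
Definition scaled_vdp (mu l : R) (X Y : R -> R) : Prop :=
  forall t, is_derive X t (Y t) /\
    is_derive Y t (- X t - mu * (l * X t ^ 2 - 1) * Y t).

(** ** Bendixson-Dulac criterion, small mu *)

(* [H = Y^2 - d X * Y - q X] satisfies [H' = - La * H + N] along the orbit; the
   relation between [q'] and [d] is what cancels the terms linear in [Y]. *)
Lemma no_orbit_in_strip_quadratic (mu l T t0 : R) (X Y d d' q q' : R -> R) :
  0 < mu -> l <= 1 -> 0 < T ->
  scaled_vdp mu l X Y ->
  (forall t, X (t + T) = X t /\ Y (t + T) = Y t) ->
  (forall t, -2 <= X t <= 2) -> X t0 = -2 ->
  (forall x, is_derive d x (d' x)) -> (forall x, continuous d' x) ->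
  (forall x, is_derive q x (q' x)) ->
  (forall x, q' x = -2 * x - d x * (d' x + mu * (x ^ 2 - 1))) ->
  q (-2) = 0 -> (forall x, -2 <= x <= 2 -> 0 <= q x) ->
  (forall x, -2 <= x <= 2 -> 0 <= x * d x - q x * (d' x + 2 * mu * (x ^ 2 - 1))) ->
  (forall x, -2 < x < 0 -> 0 < x * d x - q x * (d' x + 2 * mu * (x ^ 2 - 1))) ->
  False.
Proof.
  intros Hmu Hl HT Hsol Hper HX Ht0 Hd Hd' Hq Hq' Hq2 Hqp HC HCs.
  set (Th := fun x => d' x + 2 * mu * (x ^ 2 - 1)).
  set (C := fun x => x * d x - q x * Th x).
  set (H := fun t => Y t ^ 2 - d (X t) * Y t - q (X t)).
  (* The case [l < 1] is absorbed by the terms with [mu * (1 - l)]; the one in [N] is nonnegative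
     because [q >= 0] on the strip. *)
  set (La := fun t => Th (X t) - mu * (1 - l) * X t ^ 2).
  set (N := fun t => C (X t) + mu * (1 - l) * X t ^ 2 * (Y t ^ 2 + q (X t))).
  assert (HXd : forall t, is_derive X t (Y t)) by (intros t; apply Hsol).
  assert (HYd : forall t, is_derive Y t (- X t - mu * (l * X t ^ 2 - 1) * Y t))
    by (intros t; apply Hsol).
  assert (HH : forall t, is_derive H t (- La t * H t + N t)).
  { intros t. unfold H.
    auto_derive.
    - repeat split; eexists; eauto.
    - rewrite (is_derive_unique (fun t : R => Y t : R) t _ (HYd t)),
        (is_derive_unique (fun t : R => X t : R) t _ (HXd t)),
        (is_derive_unique (fun x : R => d x : R) _ _ (Hd (X t))),
        (is_derive_unique (fun x : R => q x : R) _ _ (Hq (X t))), Hq'.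
      unfold La, N, C, Th, H. ring. }
  assert (HLc : forall t, continuous La t).
  { intros t. unfold La, Th.
    assert (HcX : continuous X t)
      by (apply (@ex_derive_continuous _ _ X); eexists; apply HXd).
    assert (HcX2 : continuous (fun t => X t ^ 2) t).
    { apply (continuous_comp X (fun x => x ^ 2)); [exact HcX|].
      apply (@ex_derive_continuous _ _ (fun x : R => x ^ 2)). auto_derive. exact I. }
    apply (continuous_minus (fun t => d' (X t) + 2 * mu * (X t ^ 2 - 1))
             (fun t => mu * (1 - l) * X t ^ 2)).
    - apply (continuous_plus (fun t => d' (X t)) (fun t => 2 * mu * (X t ^ 2 - 1))).
      + apply (continuous_comp X d'); auto.
      + apply (continuous_mult (fun _ => 2 * mu) (fun t => X t ^ 2 - 1)).
        * apply continuous_const.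
        * apply (continuous_minus (fun t => X t ^ 2) (fun _ => 1)); auto.
          apply continuous_const.
    - apply (continuous_mult (fun _ => mu * (1 - l)) (fun t => X t ^ 2)); auto.
      apply continuous_const. }
  (* [exp I] is an integrating factor: it turns the relation for [H] into [W' = exp I * N >= 0]. *)
  set (I := fun t => RInt La t0 t).
  assert (HI : forall t, is_derive I t (La t)).
  { intros t. apply (is_derive_RInt La I t0 t); [|apply HLc].
    apply filter_forall. intros u. apply (RInt_correct La).
    apply (ex_RInt_continuous La). auto. }
  set (W := fun t => exp (I t) * H t).
  assert (HW : forall t, is_derive W t (exp (I t) * N t)).
  { intros t. unfold W. auto_derive.
    - repeat split; eexists; eauto.
    - rewrite (is_derive_unique (fun t : R => I t : R) t _ (HI t)),
        (is_derive_unique (fun t : R => H t : R) t _ (HH t)). ring. }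
  assert (HN : forall t, 0 <= N t).
  { intros t. unfold N. apply Rplus_le_le_0_compat; [apply HC, HX|].
    apply Rmult_le_pos.
    - apply Rmult_le_pos; [apply Rmult_le_pos; lra|apply pow2_ge_0].
    - apply Rplus_le_le_0_compat; [apply pow2_ge_0|apply Hqp, HX]. }
  assert (HWn : forall t, 0 <= exp (I t) * N t).
  { intros t. apply Rmult_le_pos; [left; apply exp_pos|apply HN]. }
  assert (HYx : forall t, X t = -2 -> Y t = 0).
  { intros t Ht. apply (derive_at_min X t); auto. intros s. rewrite Ht. apply HX. }
  assert (HW0 : W t0 = 0).
  { unfold W, H. rewrite Ht0, Hq2, (HYx t0 Ht0). ring. }
  assert (HWT : W (t0 + T) = 0).
  { unfold W, H. destruct (Hper t0) as [-> ->].
    rewrite Ht0, Hq2, (HYx t0 Ht0). ring. }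
  (* [W] is nondecreasing and vanishes at both ends of a period. *)
  assert (HWc : forall t, t0 <= t <= t0 + T -> W t = 0).
  { intros t Ht. apply Rle_antisym.
    - rewrite <- HWT. apply (derive_nonneg_le W (fun t => exp (I t) * N t)); auto; lra.
    - rewrite <- HW0 at 1. apply (derive_nonneg_le W (fun t => exp (I t) * N t)); auto; lra. }
  (* Just after [t0] the orbit is inside the strip, where [C > 0]. *)
  destruct (derive_pos_right Y t0 _ (HYd t0)) as [del [Hdel HY]].
  { rewrite (HYx t0 Ht0), Ht0. lra. }
  assert (Hcont : continuity_pt X t0) by (eapply is_derive_continuity, HXd).
  destruct (Hcont 1 ltac:(lra)) as [del2 [Hdel2 Hc2]].
  (* [del] gives [Y s > 0], [del2] keeps [X s] within 1 of -2, and [T] keeps [s] inside the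
     period. *)
  set (s := t0 + Rmin (Rmin del del2) T / 2).
  assert (Hs : t0 < s < t0 + del /\ s < t0 + del2 /\ s < t0 + T).
  { unfold s. generalize (Rmin_l (Rmin del del2) T) (Rmin_r (Rmin del del2) T)
      (Rmin_l del del2) (Rmin_r del del2).
    assert (0 < Rmin (Rmin del del2) T) by (repeat apply Rmin_glb_lt; lra). lra. }
  assert (HYs : Y s <> 0).
  { specialize (HY s ltac:(lra)). rewrite (HYx t0 Ht0) in HY. lra. }
  assert (HXs : -2 < X s < 0).
  { split.
    - destruct (HX s) as [[?|He] _]; [assumption|]. exfalso. apply HYs, HYx. lra.
    - specialize (Hc2 s). unfold D_x, no_cond, dist in Hc2; simpl in Hc2.
      unfold Rdist in Hc2. rewrite (Rabs_right (s - t0)) in Hc2 by lra.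
      assert (Hx := Hc2 ltac:(repeat split; lra)).
      apply Rabs_def2 in Hx. lra. }
  assert (HNs : 0 < exp (I s) * N s).
  { apply Rmult_lt_0_compat; [apply exp_pos|]. unfold N.
    apply Rplus_lt_le_0_compat; [apply HCs, HXs|].
    apply Rmult_le_pos.
    - apply Rmult_le_pos; [apply Rmult_le_pos; lra|apply pow2_ge_0].
    - apply Rplus_le_le_0_compat; [apply pow2_ge_0|apply Hqp, HX]. }
  destruct (derive_pos_right W s _ (HW s) HNs) as [del3 [Hdel3 HW3]].
  set (u := s + Rmin del3 (t0 + T - s) / 2).
  assert (Hu : s < u < s + del3 /\ u < t0 + T).
  { unfold u. generalize (Rmin_l del3 (t0 + T - s)) (Rmin_r del3 (t0 + T - s)).
    assert (0 < Rmin del3 (t0 + T - s)) by (apply Rmin_glb_lt; lra). lra. }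
  specialize (HW3 u ltac:(lra)).
  rewrite (HWc s), (HWc u) in HW3 by lra. lra.
Qed.

(* With [w = x^2], [nu = mu^2] and [r = 4 * nu / (8 + nu)] the criterion is used
   for [d x = mu * x * profile r w] and [q x = 4 - w + nu * excess r w].  At
   [r = 0], [profile] is the value found by perturbation theory; the correction
   of first order in [r] was fitted numerically. *)
Definition profile (r w : R) : R :=
  (4 - w) * (1000 + r * w * (w ^ 2 + 4 * w - 30)) / 2000.

Definition profile' (r w : R) : R :=
  (- (1000 + r * w * (w ^ 2 + 4 * w - 30)) +
   (4 - w) * (r * (3 * w ^ 2 + 8 * w - 30))) / 2000.

Definition excess (r w : R) : R :=
  (4 - w) ^ 2 *
  (1000000 * (1 - w) +
   r * (-43200 - 21600 * w + 149400 * w ^ 2 - 17200 * w ^ 3 - 5000 * w ^ 4) +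
   r ^ 2 * w ^ 3 * (-2700 + 720 * w + 132 * w ^ 2 - 24 * w ^ 3 - 3 * w ^ 4))
  / 24000000.

(** [mu * slope r (x ^ 2)] is the factor [d' x + 2 * mu * (x ^ 2 - 1)] of the criterion. *)
Definition slope (r w : R) : R :=
  profile r w + 2 * w * profile' r w + 2 * (w - 1).

Ltac positive_terms :=
  repeat first
    [ apply Rplus_lt_0_compat | apply Rmult_lt_0_compat | apply pow_lt | lra ].

(* The functions of [x], [y] (and [r], [s]) below are Bernstein expansions: [x] and
   [y] stand for the distances to the two ends of an interval, [s] for
   [23 / 8 - r], and all coefficients are positive. *)
Definition slack_left (x y r s : R) : R :=
  ((640000000 * s ^ 3 + 4983600000 * r * s ^ 2 + 7018824000 * r ^ 2 * s +
   2675224000 * r ^ 3) * y ^ 11 +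
   (14560000000 * s ^ 3 + 55566400000 * r * s ^ 2 + 56940512000 * r ^ 2 * s +
    15934112000 * r ^ 3) * x * y ^ 10 +
   (102784000000 * s ^ 3 + 278930400000 * r * s ^ 2 + 216343674000 * r ^ 2 * s +
    40197274000 * r ^ 3) * x ^ 2 * y ^ 9 +
   (377376000000 * s ^ 3 + 837672800000 * r * s ^ 2 + 520101992800 * r ^ 2 * s +
    58326902300 * r ^ 3) * x ^ 3 * y ^ 8 +
   (854784000000 * s ^ 3 + 1679385600000 * r * s ^ 2 + 892757231800 * r ^ 2 * s +
    59745801400 * r ^ 3) * x ^ 4 * y ^ 7 +
   (1288896000000 * s ^ 3 + 2365229600000 * r * s ^ 2 + 1150317063400 * r ^ 2 * s +
    54449770745 * r ^ 3) * x ^ 5 * y ^ 6 +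
   (1338624000000 * s ^ 3 + 2389036000000 * r * s ^ 2 + 1123668345000 * r ^ 2 * s +
    49465358210 * r ^ 3) * x ^ 6 * y ^ 5 +
   (965184000000 * s ^ 3 + 1729010400000 * r * s ^ 2 + 820877999800 * r ^ 2 * s +
    40889139505 * r ^ 3) * x ^ 7 * y ^ 4 +
   (475776000000 * s ^ 3 + 876974800000 * r * s ^ 2 + 434442909000 * r ^ 2 * s +
    27348613484 * r ^ 3) * x ^ 8 * y ^ 3 +
   (153184000000 * s ^ 3 + 296141600000 * r * s ^ 2 + 157118840600 * r ^ 2 * s +
    13264009519 * r ^ 3) * x ^ 9 * y ^ 2 +
   (29056000000 * s ^ 3 + 59752000000 * r * s ^ 2 + 34601918600 * r ^ 2 * s +
    3948624770 * r ^ 3) * x ^ 10 * y +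
   (2464000000 * s ^ 3 + 5441600000 * r * s ^ 2 + 3476493800 * r ^ 2 * s +
    519589867 * r ^ 3) * x ^ 11) / 584016000000000.

Definition slack_right (x y r s : R) : R :=
  ((294230425600000 * s ^ 3 + 558351974400000 * r * s ^ 2 + 289610792064000 * r ^ 2 * s +
   22781461511731 * r ^ 3) * y ^ 11 +
   (3149502873600000 * s ^ 3 + 6230476390400000 * r * s ^ 2 +
    3433365312640000 * r ^ 2 * s + 341382670828400 * r ^ 3) * x * y ^ 10 +
   (14772338688000000 * s ^ 3 + 31550513152000000 * r * s ^ 2 +
    19163814634880000 * r ^ 2 * s + 2477946640175080 * r ^ 3) * x ^ 2 * y ^ 9 +
   (40164655104000000 * s ^ 3 + 95298789376000000 * r * s ^ 2 +
    65073327217280000 * r ^ 2 * s + 10720057997296960 * r ^ 3) * x ^ 3 * y ^ 8 +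
   (70357352448000000 * s ^ 3 + 189685522432000000 * r * s ^ 2 +
    147756840560640000 * r ^ 2 * s + 30731312520672320 * r ^ 3) * x ^ 4 * y ^ 7 +
   (83306427187200000 * s ^ 3 + 259469749452800000 * r * s ^ 2 +
    233308874281728000 * r ^ 2 * s + 60429502876567552 * r ^ 3) * x ^ 5 * y ^ 6 +
   (67980440371200000 * s ^ 3 + 246911511756800000 * r * s ^ 2 +
    257566361661440000 * r ^ 2 * s + 80808253557849600 * r ^ 3) * x ^ 6 * y ^ 5 +
   (38302384128000000 * s ^ 3 + 161810112512000000 * r * s ^ 2 +
    194254572615680000 * r ^ 2 * s + 71128957770977280 * r ^ 3) * x ^ 7 * y ^ 4 +
   (14762901504000000 * s ^ 3 + 70545227776000000 * r * s ^ 2 +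
    94717781524480000 * r ^ 2 * s + 38811297749237760 * r ^ 3) * x ^ 8 * y ^ 3 +
   (3835691008000000 * s ^ 3 + 19030147072000000 * r * s ^ 2 +
    26821382307840000 * r ^ 2 * s + 11635107326853120 * r ^ 3) * x ^ 9 * y ^ 2 +
   (651794841600000 * s ^ 3 + 2725930598400000 * r * s ^ 2 +
    3491484401664000 * r ^ 2 * s + 1417195548573696 * r ^ 3) * x ^ 10 * y +
   (60397977600000 * s ^ 3 + 137782886400000 * r * s ^ 2 + 94371840000000 * r ^ 2 * s +
    16986931200000 * r ^ 3) * x ^ 11) / 712910156250000000000.

Definition cap_left (x y r s : R) : R :=
  ((96000000 * s ^ 3 + 311000000 * r * s ^ 2 + 322573600 * r ^ 2 * s +
   107573600 * r ^ 3) * y ^ 8 +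
   (768000000 * s ^ 3 + 2258000000 * r * s ^ 2 + 2114875600 * r ^ 2 * s +
    624875600 * r ^ 3) * x * y ^ 7 +
   (2688000000 * s ^ 3 + 7190000000 * r * s ^ 2 + 6119846800 * r ^ 2 * s +
    1617846800 * r ^ 3) * x ^ 2 * y ^ 6 +
   (5376000000 * s ^ 3 + 13138000000 * r * s ^ 2 + 10255387000 * r ^ 2 * s +
    2476961550 * r ^ 3) * x ^ 3 * y ^ 5 +
   (6720000000 * s ^ 3 + 15100000000 * r * s ^ 2 + 10916764600 * r ^ 2 * s +
    2471610315 * r ^ 3) * x ^ 4 * y ^ 4 +
   (5376000000 * s ^ 3 + 11206000000 * r * s ^ 2 + 7564180000 * r ^ 2 * s +
    1636649328 * r ^ 3) * x ^ 5 * y ^ 3 +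
   (2688000000 * s ^ 3 + 5258000000 * r * s ^ 2 + 3328447200 * r ^ 2 * s +
    689752318 * r ^ 3) * x ^ 6 * y ^ 2 +
   (768000000 * s ^ 3 + 1430000000 * r * s ^ 2 + 850018200 * r ^ 2 * s +
    165022570 * r ^ 3) * x ^ 7 * y +
   (96000000 * s ^ 3 + 173000000 * r * s ^ 2 + 96828600 * r ^ 2 * s +
    16872019 * r ^ 3) * x ^ 8) / 146004000000.

Definition cap_right (x y r s : R) : R :=
  ((96000000 * s ^ 3 + 173000000 * r * s ^ 2 + 96828600 * r ^ 2 * s +
   16872019 * r ^ 3) * y ^ 8 +
   (768000000 * s ^ 3 + 1338000000 * r * s ^ 2 + 699239400 * r ^ 2 * s +
    104929734 * r ^ 3) * x * y ^ 7 +
   (2688000000 * s ^ 3 + 4614000000 * r * s ^ 2 + 2272995600 * r ^ 2 * s +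
    269102466 * r ^ 3) * x ^ 2 * y ^ 6 +
   (5376000000 * s ^ 3 + 9274000000 * r * s ^ 2 + 4354870400 * r ^ 2 * s +
    337147120 * r ^ 3) * x ^ 3 * y ^ 5 +
   (6720000000 * s ^ 3 + 11880000000 * r * s ^ 2 + 5424732600 * r ^ 2 * s +
    180597795 * r ^ 3) * x ^ 4 * y ^ 4 +
   (5376000000 * s ^ 3 + 9918000000 * r * s ^ 2 + 4569741000 * r ^ 2 * s +
    12337578 * r ^ 3) * x ^ 5 * y ^ 3 +
   (2688000000 * s ^ 3 + 5258000000 * r * s ^ 2 + 2587424000 * r ^ 2 * s +
    22826148 * r ^ 3) * x ^ 6 * y ^ 2 +
   (768000000 * s ^ 3 + 1614000000 * r * s ^ 2 + 908130000 * r ^ 2 * s +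
    61837992 * r ^ 3) * x ^ 7 * y +
   (96000000 * s ^ 3 + 219000000 * r * s ^ 2 + 150000000 * r ^ 2 * s +
    27000000 * r ^ 3) * x ^ 8) / 146004000000.

(** * Positivity of the polynomials in the criterion for small mu *)

(** The left side is the criterion multiplied by [4 - r], which turns [mu ^ 2] into [8 * r] and
    leaves a polynomial in [r] and [w]. The factor [r * w * (4 - w)] carries its zeros at the
    ends. *)
Lemma slack_left_eq (r w : R) :
  (4 - r) * (w * profile r w - (4 - w) * slope r w) - 8 * r * excess r w * slope r w
  = r * w * (4 - w) * slack_left w (2 - w) r (23 / 8 - r).
Proof. unfold slope, excess, profile, profile', slack_left. field. Qed.

Lemma slack_right_eq (r w : R) :
  (4 - r) * (w * profile r w - (4 - w) * slope r w) - 8 * r * excess r w * slope r w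
  = r * w * (4 - w) * slack_right (w - 3 / 2) (4 - w) r (23 / 8 - r).
Proof. unfold slope, excess, profile, profile', slack_right. field. Qed.

Lemma cap_left_eq (r w : R) :
  (4 - r) * (4 - w) + 8 * r * excess r w
  = (4 - w) * cap_left w (2 - w) r (23 / 8 - r).
Proof. unfold excess, cap_left. field. Qed.

Lemma cap_right_eq (r w : R) :
  (4 - r) * (4 - w) + 8 * r * excess r w
  = (4 - w) * cap_right (w - 2) (4 - w) r (23 / 8 - r).
Proof. unfold excess, cap_right. field. Qed.

Ltac nonneg_terms :=
  repeat first
    [ apply Rplus_le_le_0_compat | apply Rmult_le_pos | apply pow_le | lra ].

Lemma slack_left_pos (x y r s : R) :
  0 < x -> 0 < y -> 0 < r -> 0 < s -> 0 < slack_left x y r s.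
Proof. intros. unfold slack_left. positive_terms. Qed.

Lemma slack_right_pos (x y r s : R) :
  0 < x -> 0 < y -> 0 < r -> 0 < s -> 0 < slack_right x y r s.
Proof. intros. unfold slack_right. positive_terms. Qed.

Lemma cap_left_nonneg (x y r s : R) :
  0 <= x -> 0 <= y -> 0 <= r -> 0 <= s -> 0 <= cap_left x y r s.
Proof. intros. unfold cap_left. nonneg_terms. Qed.

Lemma cap_right_nonneg (x y r s : R) :
  0 <= x -> 0 <= y -> 0 <= r -> 0 <= s -> 0 <= cap_right x y r s.
Proof. intros. unfold cap_right. nonneg_terms. Qed.

(** The right expansion starts at 3/2, so that its variable [w - 3 / 2] is still strictly positive
    where the cases meet at [w = 2]. *)
Lemma slack_pos (r w : R) :
  0 < r < 23 / 8 -> 0 < w < 4 ->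
  0 < (4 - r) * (w * profile r w - (4 - w) * slope r w) - 8 * r * excess r w * slope r w.
Proof.
  intros Hr Hw.
  assert (0 < r * w * (4 - w)) by (repeat apply Rmult_lt_0_compat; lra).
  destruct (Rlt_or_le w 2).
  - rewrite slack_left_eq. apply Rmult_lt_0_compat; [assumption|].
    apply slack_left_pos; lra.
  - rewrite slack_right_eq. apply Rmult_lt_0_compat; [assumption|].
    apply slack_right_pos; lra.
Qed.

(** This is [(4 - r) * q >= 0], again with [mu ^ 2] eliminated. *)
Lemma cap_nonneg (r w : R) :
  0 < r < 23 / 8 -> 0 <= w <= 4 -> 0 <= (4 - r) * (4 - w) + 8 * r * excess r w.
Proof.
  intros Hr Hw.
  destruct (Rle_or_lt w 2).
  - rewrite cap_left_eq. apply Rmult_le_pos; [|apply cap_left_nonneg]; lra.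
  - rewrite cap_right_eq. apply Rmult_le_pos; [|apply cap_right_nonneg]; lra.
Qed.

Lemma no_orbit_in_strip_small_mu (mu l T t0 : R) (X Y : R -> R) :
  0 < mu <= 9 / 2 -> l <= 1 -> 0 < T ->
  scaled_vdp mu l X Y ->
  (forall t, X (t + T) = X t /\ Y (t + T) = Y t) ->
  (forall t, -2 <= X t <= 2) -> X t0 = -2 -> False.
Proof.
  intros Hmu Hl HT Hsol Hper HX Ht0.
  (* This parameter stays below 4; for [mu <= 9 / 2] it is at most 324/113, just below 23/8. *)
  set (r := 4 * mu ^ 2 / (8 + mu ^ 2)).
  assert (Hmu2 : 0 < mu ^ 2 <= 81 / 4) by nra.
  assert (Hr4 : mu ^ 2 * (4 - r) = 8 * r) by (unfold r; field; lra).
  assert (Hr : 0 < r < 23 / 8) by (split; nra).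
  assert (Hcrit : forall w, (4 - r) * (w * profile r w - (4 - w +
  mu ^ 2 * excess r w) * slope r w) =
     (4 - r) * (w * profile r w - (4 - w) * slope r w) - 8 * r * excess r w * slope r w).
  { intros w. rewrite <- Hr4. ring. }
  assert (Hpos : forall w, 0 < w < 4 ->
     0 < w * profile r w - (4 - w + mu ^ 2 * excess r w) * slope r w).
  { intros w Hw. assert (H := slack_pos r w Hr Hw). rewrite <- Hcrit in H.
    apply Rmult_lt_reg_l with (4 - r); lra. }
  apply (no_orbit_in_strip_quadratic mu l T t0 X Y
    (fun x => mu * x * profile r (x ^ 2))
    (fun x => mu * (profile r (x ^ 2) + 2 * x ^ 2 * profile' r (x ^ 2)))
    (fun x => 4 - x ^ 2 + mu ^ 2 * excess r (x ^ 2))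
    (fun x => -2 * x - mu * x * profile r (x ^ 2) *
       (mu * (profile r (x ^ 2) + 2 * x ^ 2 * profile' r (x ^ 2)) + mu * (x ^ 2 - 1))));
    auto; try lra.
  - intros x. unfold profile, profile'. auto_derive; [exact I|]. field.
  - intros x. apply (@ex_derive_continuous _ _ (fun x => mu * (profile r (x ^ 2) +
      2 * x ^ 2 * profile' r (x ^ 2)))).
    unfold profile, profile'. auto_derive. exact I.
  - intros x. unfold excess, profile, profile'. auto_derive; [exact I|]. field.
  - unfold excess. field.
  - intros x Hx. apply Rmult_le_reg_l with (4 - r); [lra|].
    rewrite Rmult_0_r.
    replace ((4 - r) * (4 - x ^ 2 + mu ^ 2 * excess r (x ^ 2)))
      with ((4 - r) * (4 - x ^ 2) + mu ^ 2 * (4 - r) * excess r (x ^ 2)) by ring.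
    rewrite Hr4. apply cap_nonneg; [exact Hr|nra].
  - intros x Hx.
    replace (_ - _) with (mu * (x ^ 2 * profile r (x ^ 2) -
      (4 - x ^ 2 + mu ^ 2 * excess r (x ^ 2)) * slope r (x ^ 2))) by (unfold slope; ring).
    apply Rmult_le_pos; [lra|].
    assert (Hw : 0 <= x ^ 2 <= 4) by nra.
    (* At [w = 0] and [w = 4] the expression vanishes: [slope r 0 = 0], and [profile], [excess] and
       [4 - w] are all zero at 4. *)
    destruct (Req_dec (x ^ 2) 0) as [H0|H0].
    { rewrite H0. unfold slope, profile, profile'. right. field. }
    destruct (Req_dec (x ^ 2) 4) as [H4|H4].
    { rewrite H4. unfold excess, profile. right. field. }
    left. apply Hpos. lra.
  - intros x Hx.
    replace (_ - _) with (mu * (x ^ 2 * profile r (x ^ 2) -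
      (4 - x ^ 2 + mu ^ 2 * excess r (x ^ 2)) * slope r (x ^ 2))) by (unfold slope; ring).
    apply Rmult_lt_0_compat; [lra|]. apply Hpos. nra.
Qed.

(** ** Barriers for large mu *)

(* The barrier [2 - X = layer k], where [k] is [J] in units of [mu^(-1/3)]; in the
   limit of small [k] the coefficient of [k^3] has to be below [1/3]. *)
Definition layer (k : R) : R := 13 / 50 * k ^ 3 + 39 / 200 * k ^ 6.

Definition layer' (k : R) : R := 39 / 50 * k ^ 2 + 117 / 100 * k ^ 5.

(* [M = mu^(2/3)] is at least [27 / 10]; the inequality of [late_barrier] is checked
   at [M = 27 / 10] ([margin]), and so is the sign of its derivative in [M]
   ([growth]). *)
Definition margin_left (x y : R) : R :=
  (35830181101531738262208512 * y ^ 18 +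
   577258023779946529854324736 * x * y ^ 17 +
   4379346263225584426812440576 * x ^ 2 * y ^ 16 +
   20890269357284196510871846912 * x ^ 3 * y ^ 15 +
   70571232604068385811930808320 * x ^ 4 * y ^ 14 +
   180133739088511035289334972416 * x ^ 5 * y ^ 13 +
   361369468493621617335294230528 * x ^ 6 * y ^ 12 +
   583796126317966430695727300608 * x ^ 7 * y ^ 11 +
   770141507910530871799563616256 * x ^ 8 * y ^ 10 +
   834738201902676074957008240640 * x ^ 9 * y ^ 9 +
   743443467659060930908102967296 * x ^ 10 * y ^ 8 +
   541409111489477517294505422848 * x ^ 11 * y ^ 7 +
   319232886867035025376780607488 * x ^ 12 * y ^ 6 +
   150007088022311891560840587776 * x ^ 13 * y ^ 5 +
   54810779910716713799900072320 * x ^ 14 * y ^ 4 +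
   14982113857318072160423103392 * x ^ 15 * y ^ 3 +
   2874217353421056079639547056 * x ^ 16 * y ^ 2 +
   344254927644878970216392456 * x ^ 17 * y +
   19425799175345277700771557 * x ^ 18) /
  3051757812500000000000.

Definition margin_right (x y : R) : R :=
  (19425799175345277700771557 * y ^ 18 +
   355073842667551027011383596 * x * y ^ 17 +
   3058138908806481045154396436 * x ^ 2 * y ^ 16 +
   16529777829995535420961630432 * x ^ 3 * y ^ 15 +
   63312015070044665466790027520 * x ^ 4 * y ^ 14 +
   185560942712972697290346510976 * x ^ 5 * y ^ 13 +
   444217921273848931928780791808 * x ^ 6 * y ^ 12 +
   922711966598624494972369151488 * x ^ 7 * y ^ 11 +
   1732626003836535881117711254016 * x ^ 8 * y ^ 10 +
   2946588635351772574989255639040 * x ^ 9 * y ^ 9 +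
   4394717216591226780543973574656 * x ^ 10 * y ^ 8 +
   5514419991634887716109027811328 * x ^ 11 * y ^ 7 +
   5618782489393719308409685639168 * x ^ 12 * y ^ 6 +
   4515290872586391113975595892736 * x ^ 13 * y ^ 5 +
   2778712255989993027594588651520 * x ^ 14 * y ^ 4 +
   1260252038588051380320904282112 * x ^ 15 * y ^ 3 +
   396515869348308727755917295616 * x ^ 16 * y ^ 2 +
   77281676153457478687991791616 * x ^ 17 * y +
   7029639142148412238366769152 * x ^ 18) /
  3051757812500000000000.

Definition growth_left (x y : R) : R :=
  (20140288109142727458816 * y ^ 16 + 1083436212355421360357376 * x * y ^ 15 +
   13806436100290557216030720 * x ^ 2 * y ^ 14 +
   90877547375558379369922560 * x ^ 3 * y ^ 13 +
   381359448184339432604958720 * x ^ 4 * y ^ 12 +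
   1122457636665407808294617088 * x ^ 5 * y ^ 11 +
   2440303462841421965239615488 * x ^ 6 * y ^ 10 +
   4037782498099079875022192640 * x ^ 7 * y ^ 9 +
   5170350974641019461429125120 * x ^ 8 * y ^ 8 +
   5161026614364352800151050240 * x ^ 9 * y ^ 7 +
   4013118594376434033863344128 * x ^ 10 * y ^ 6 +
   2409435622560928454430133248 * x ^ 11 * y ^ 5 +
   1096162317639493457605249920 * x ^ 12 * y ^ 4 +
   365521562811542706938734560 * x ^ 13 * y ^ 3 +
   84267228544855044972959520 * x ^ 14 * y ^ 2 +
   11998201648732527495317856 * x ^ 15 * y + 794517203457127159442511 * x ^ 16) /
  6103515625000000000.

Definition growth_right (x y : R) : R :=
  (794517203457127159442511 * y ^ 16 + 13426348861895541606842496 * x * y ^ 15 +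
   105689436742300256645829120 * x ^ 2 * y ^ 14 +
   514153215464666678573081760 * x ^ 3 * y ^ 13 +
   1728759838151762247364341120 * x ^ 4 * y ^ 12 +
   4255614548308486264963246848 * x ^ 5 * y ^ 11 +
   7923398758069160205416898048 * x ^ 6 * y ^ 10 +
   11363717533150821870923773440 * x ^ 7 * y ^ 9 +
   12663885036667127833125803520 * x ^ 8 * y ^ 8 +
   10980116397807914325501911040 * x ^ 9 * y ^ 7 +
   7368346106412131657744498688 * x ^ 10 * y ^ 6 +
   3783339641836747971257131008 * x ^ 11 * y ^ 5 +
   1460348390514145140407992320 * x ^ 12 * y ^ 4 +
   413826029863665300277493760 * x ^ 13 * y ^ 3 +
   83430475697442657826897920 * x ^ 14 * y ^ 2 +
   11285528617676197767806976 * x ^ 15 * y + 826684535809274935443456 * x ^ 16) /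
  6103515625000000000.

Lemma margin_left_eq (k : R) :
  729 / 100 * (layer k * (3 - layer k) ^ 2 / 3) -
    27 / 10 * ((2 - layer k) * layer' k) + k
  = margin_left (k - 2 / 5) (9 / 10 - k).
Proof. unfold layer, layer', margin_left. field. Qed.

Lemma margin_right_eq (k : R) :
  729 / 100 * (layer k * (3 - layer k) ^ 2 / 3) -
    27 / 10 * ((2 - layer k) * layer' k) + k
  = margin_right (k - 9 / 10) (7 / 5 - k).
Proof. unfold layer, layer', margin_right. field. Qed.

Lemma growth_left_eq (k : R) :
  27 / 5 * (layer k * (3 - layer k) ^ 2 / 3) - (2 - layer k) * layer' k
  = k ^ 2 * growth_left (k - 2 / 5) (9 / 10 - k).
Proof. unfold layer, layer', growth_left. field. Qed.

Lemma growth_right_eq (k : R) :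
  27 / 5 * (layer k * (3 - layer k) ^ 2 / 3) - (2 - layer k) * layer' k
  = k ^ 2 * growth_right (k - 9 / 10) (7 / 5 - k).
Proof. unfold layer, layer', growth_right. field. Qed.

Lemma margin_left_nonneg (x y : R) : 0 <= x -> 0 <= y -> 0 <= margin_left x y.
Proof. intros. unfold margin_left. nonneg_terms. Qed.

Lemma margin_right_nonneg (x y : R) : 0 <= x -> 0 <= y -> 0 <= margin_right x y.
Proof. intros. unfold margin_right. nonneg_terms. Qed.

Lemma growth_left_nonneg (x y : R) : 0 <= x -> 0 <= y -> 0 <= growth_left x y.
Proof. intros. unfold growth_left. nonneg_terms. Qed.

Lemma growth_right_nonneg (x y : R) : 0 <= x -> 0 <= y -> 0 <= growth_right x y.
Proof. intros. unfold growth_right. nonneg_terms. Qed.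

Lemma layer_nonneg (k : R) : 0 <= k -> 0 <= layer k.
Proof. intros. unfold layer. nonneg_terms. Qed.

Lemma layer'_nonneg (k : R) : 0 <= k -> 0 <= layer' k.
Proof. intros. unfold layer'. nonneg_terms. Qed.

(** Lets the barrier start at [X = 0], and confines [k] to [[0, 7/5]] as long as [layer k <= 2]. *)
Lemma layer_bound (k : R) : 7 / 5 <= k -> 2 < layer k.
Proof.
  intros H. unfold layer.
  assert ((7 / 5) ^ 3 <= k ^ 3) by (apply pow_incr; lra).
  assert ((7 / 5) ^ 6 <= k ^ 6) by (apply pow_incr; lra). lra.
Qed.

(** On the barrier [X = 2 - layer k] the right side is [m * Y] up to a constant, and the left side
    is the loss [m ^ 2 * X * layer' k]. Small [k] is settled by a discriminant, larger [k] by
    expanding the quadratic in [M] at 27/10. *)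
Lemma late_barrier (M k : R) :
  27 / 10 <= M -> 0 <= k -> layer k <= 2 ->
  M * ((2 - layer k) * layer' k) <= M ^ 2 * (layer k * (3 - layer k) ^ 2 / 3) + k.
Proof.
  intros HM Hk HZ.
  assert (Hk2 : k <= 7 / 5).
  { destruct (Rle_or_lt k (7 / 5)) as [|H]; [assumption|].
    assert (2 < layer k) by (apply layer_bound; lra). lra. }
  assert (HZ0 := layer_nonneg k Hk).
  set (G := layer k * (3 - layer k) ^ 2 / 3).
  set (B := (2 - layer k) * layer' k).
  destruct (Rle_or_lt k (2 / 5)) as [Hs|Hs].
  - (* Here [B ^ 2 <= 4 * G * k], so the quadratic in [M] has no real root. *)
    destruct Hk as [Hk|<-].
    2: { unfold G, B, layer, layer'. right. field. }
    set (p := 13 / 50 + 39 / 200 * k ^ 3). set (e := 39 / 50 + 117 / 100 * k ^ 3).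
    assert (Hp : layer k = k ^ 3 * p) by (unfold layer, p; ring).
    assert (He : layer' k = k ^ 2 * e) by (unfold layer', e; ring).
    assert (Hk3 : 0 <= k ^ 3 <= 8 / 125).
    { split; [apply pow_le; lra|].
      replace (8 / 125) with ((2 / 5) ^ 3) by field. apply pow_incr; lra. }
    (* At [k = 0] this reads [(3 * c) ^ 2 <= 3 * c] with [c = 13 / 50], hence the bound 1/3 on
       [c]. *)
    assert (Hep : e ^ 2 <= 3 * p) by (unfold e, p; nra).
    assert (Hp0 : 0 < p) by (unfold p; lra).
    assert (HG : 0 < G).
    { unfold G. rewrite Hp. apply Rdiv_lt_0_compat; [|lra].
      apply Rmult_lt_0_compat; [apply Rmult_lt_0_compat; [apply pow_lt|]; lra|].
      apply pow_lt. lra. }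
    assert (HB : B ^ 2 <= 4 * G * k).
    { unfold B, G. rewrite He.
      replace (((2 - layer k) * (k ^ 2 * e)) ^ 2)
        with (k ^ 4 * ((2 - layer k) ^ 2 * e ^ 2)) by ring.
      replace (4 * (layer k * (3 - layer k) ^ 2 / 3) * k)
        with (k ^ 4 * (4 / 9 * (3 - layer k) ^ 2 * (3 * p))) by (rewrite Hp; field).
      apply Rmult_le_compat_l; [apply pow_le; lra|].
      apply Rmult_le_compat; [apply pow2_ge_0|apply pow2_ge_0| |exact Hep].
      nra. }
    assert (0 <= 4 * G * (M ^ 2 * G + k - M * B)).
    { replace (4 * G * (M ^ 2 * G + k - M * B))
        with ((2 * M * G - B) ^ 2 + (4 * G * k - B ^ 2)) by ring.
      generalize (pow2_ge_0 (2 * M * G - B)). lra. }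
    assert (0 <= M ^ 2 * G + k - M * B) by (apply Rmult_le_reg_l with (4 * G); lra).
    lra.
  - assert (H1 : 0 <= 729 / 100 * G - 27 / 10 * B + k).
    { destruct (Rle_or_lt k (9 / 10)).
      - unfold G, B. rewrite margin_left_eq. apply margin_left_nonneg; lra.
      - unfold G, B. rewrite margin_right_eq. apply margin_right_nonneg; lra. }
    assert (H2 : 0 <= 27 / 5 * G - B).
    { assert (0 <= k ^ 2) by apply pow2_ge_0.
      destruct (Rle_or_lt k (9 / 10)).
      - unfold G, B. rewrite growth_left_eq.
        apply Rmult_le_pos; [|apply growth_left_nonneg]; lra.
      - unfold G, B. rewrite growth_right_eq.
        apply Rmult_le_pos; [|apply growth_right_nonneg]; lra. }
    assert (HG : 0 <= G).
    { unfold G. apply Rmult_le_pos; [|lra].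
      apply Rmult_le_pos; [lra|apply pow2_ge_0]. }
    (* These are the terms of degree 1 and 2 in the Taylor expansion at 27/10; [H1] is the constant
       term. *)
    assert (0 <= (M - 27 / 10) * ((M - 27 / 10) * G + (27 / 5 * G - B))).
    { apply Rmult_le_pos; [lra|].
      apply Rplus_le_le_0_compat; [apply Rmult_le_pos|]; lra. }
    nra.
Qed.

(** Here [i = m ^ -2] and [e = m ^ 2 * (-1 - X)], and the linear barrier for [m * Y] is
    [f = 5 / 4 * (31 / 50 - e)]. The difference of the sides is [(1 - f * (2 * e + 5 / 4)) + e * i *
    (1 - e * f)]. *)
Lemma early_barrier (i e : R) :
  0 <= i -> 0 <= e <= 31 / 50 ->
  5 / 4 * (31 / 50 - e) * (2 * e + e ^ 2 * i + 5 / 4) < 1 + e * i.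
Proof.
  intros Hi He. set (f := 5 / 4 * (31 / 50 - e)).
  assert (f * (2 * e + 5 / 4) < 1) by (unfold f; nra).
  assert (0 <= e * i * (1 - e * f)).
  { apply Rmult_le_pos; [apply Rmult_le_pos; lra|]. unfold f; nra. }
  nra.
Qed.

Lemma quintic_pos (a b c d e f x y : R) :
  0 < a -> 0 <= b -> 0 <= c -> 0 <= d -> 0 <= e -> 0 < f ->
  0 <= x -> 0 <= y -> 0 < x + y ->
  0 < a * y ^ 5 + b * x * y ^ 4 + c * x ^ 2 * y ^ 3 +
      d * x ^ 3 * y ^ 2 + e * x ^ 4 * y + f * x ^ 5.
Proof.
  intros Ha Hb Hc Hd He Hf Hx Hy Hxy.
  assert (0 <= b * x * y ^ 4) by nonneg_terms.
  assert (0 <= c * x ^ 2 * y ^ 3) by nonneg_terms.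
  assert (0 <= d * x ^ 3 * y ^ 2) by nonneg_terms.
  assert (0 <= e * x ^ 4 * y) by nonneg_terms.
  destruct Hy as [Hy|<-].
  - assert (0 < a * y ^ 5) by positive_terms.
    assert (0 <= f * x ^ 5) by nonneg_terms. lra.
  - assert (0 < f * x ^ 5) by positive_terms. lra.
Qed.

(* The difference of the two sides is affine in [i], so the ends of the range of [i]
   suffice. *)
Lemma middle_barrier (i s : R) :
  0 <= i <= 10 / 27 -> 0 <= s <= 1 ->
  let x := 11 / 5 * (1 - s) in
  9 / 10 * s ^ 2 * (x ^ 2 - x ^ 3 * i / 3 + (287 / 200 - 33 / 50 * s ^ 3)) < 1 - x * i.
Proof.
  intros Hi Hs x.
  set (P := fun i => 1 - x * i -
    9 / 10 * s ^ 2 * (x ^ 2 - x ^ 3 * i / 3 + (287 / 200 - 33 / 50 * s ^ 3))).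
  assert (H0 : 0 < 2000 * P 0).
  { replace (2000 * P 0) with
      (2000 * (1 - s) ^ 5 + 10000 * s * (1 - s) ^ 4 + 8705 * s ^ 2 * (1 - s) ^ 3 +
       3539 * s ^ 3 * (1 - s) ^ 2 + 2251 * s ^ 4 * (1 - s) + 605 * s ^ 5)
      by (unfold P, x; field).
    apply quintic_pos; lra. }
  assert (H1 : 0 < 13500 * P (10 / 27)).
  { destruct (Rle_or_lt s (1 / 2)).
    - replace (13500 * P (10 / 27)) with
        (80000 * (1 / 2 - s) ^ 5 + 576000 * s * (1 / 2 - s) ^ 4 +
         1021846 * s ^ 2 * (1 / 2 - s) ^ 3 + 688322 * s ^ 3 * (1 / 2 - s) ^ 2 +
         193326 * s ^ 4 * (1 / 2 - s) + 22897 * s ^ 5)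
        by (unfold P, x; field).
      apply quintic_pos; lra.
    - replace (13500 * P (10 / 27)) with
        (22897 * (1 - s) ^ 5 + 35644 * (s - 1 / 2) * (1 - s) ^ 4 +
         57594 * (s - 1 / 2) ^ 2 * (1 - s) ^ 3 +
         300022 * (s - 1 / 2) ^ 3 * (1 - s) ^ 2 +
         393808 * (s - 1 / 2) ^ 4 * (1 - s) + 130680 * (s - 1 / 2) ^ 5)
        by (unfold P, x; field).
      apply quintic_pos; lra. }
  assert (P i = (1 - 27 / 10 * i) * P 0 + 27 / 10 * i * P (10 / 27)) by (unfold P; field).
  assert (0 < P i); [|unfold P in *; lra].
  rewrite H. nra.
Qed.

(** * Following the arch of the orbit for large mu *)

Lemma first_passage (X Y : R -> R) (a b c : R) :
  (forall t, is_derive X t (Y t)) -> a <= b -> X a < c -> c <= X b ->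
  exists s, a < s <= b /\ X s = c.
Proof.
  intros HX Hab Ha Hb.
  destruct (first_zero (fun t => c - X t) a b) as [s [Hs [Hs0 _]]]; try lra.
  - intros t _. apply is_derive_continuity with (- Y t).
    auto_derive; [eexists; apply HX|].
    rewrite (is_derive_unique (fun x : R => X x : R) _ _ (HX t)). ring.
  - exists s. split; [exact Hs|lra].
Qed.

(** With [m = mu ^ (1/3)], barriers give in turn [m * Y > 31 / 40] at [X = -1], [m * J > 287 / 200]
    at [X = -1 + 11 / 5 * m ^ -2] and still at [X = 0], and finally [X > 2] when [m * J] has dropped
    to 3/100. *)
Lemma no_orbit_in_strip_large_mu (mu l T t0 : R) (X Y : R -> R) :
  9 / 2 <= mu -> l <= 1 -> 0 < T ->
  scaled_vdp mu l X Y ->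
  (forall t, X (t + T) = X t /\ Y (t + T) = Y t) ->
  (forall t, -2 <= X t <= 2) -> X t0 = -2 -> False.
Proof.
  intros Hmu Hl HT Hsol Hper HX Ht0.
  assert (HXd : forall t, is_derive X t (Y t)) by (intros t; apply Hsol).
  assert (HYd : forall t, is_derive Y t (- X t - mu * (l * X t ^ 2 - 1) * Y t))
    by (intros t; apply Hsol).
  set (m := Rpower mu (/ 3)).
  assert (Hm : 0 < m) by apply exp_pos.
  assert (Hm3 : m ^ 3 = mu).
  { unfold m. rewrite <- Rpower_pow by apply exp_pos. rewrite Rpower_mult.
    replace (/ 3 * INR 3) with 1 by (simpl; field). apply Rpower_1. lra. }
  assert (HM : 27 / 10 <= m ^ 2).
  { destruct (Rle_or_lt (27 / 10) (m ^ 2)) as [|H]; [assumption|exfalso].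
    (* 1.644 is just above the square root of 27/10, and its cube is below 9/2. *)
    assert (m < 1644 / 1000) by nra. nra. }
  assert (HY0 : forall t, X t = -2 -> Y t = 0).
  { intros t Ht. apply (derive_at_min X t); auto. intros s. rewrite Ht. apply HX. }
  destruct (derive_pos_right Y t0 _ (HYd t0)) as [del [Hdel Hinc]].
  { rewrite (HY0 t0 Ht0), Ht0. lra. }
  rewrite (HY0 t0 Ht0) in Hinc.
  set (a := t0 + Rmin del T / 2).
  assert (Ha : t0 < a < t0 + del /\ a < t0 + T).
  { unfold a. generalize (Rmin_l del T) (Rmin_r del T).
    assert (0 < Rmin del T) by (apply Rmin_glb_lt; lra). lra. }
  destruct (first_zero Y a (t0 + T)) as [t1 [Ht1 [HYt1 HYa]]].
  - intros t _. eapply is_derive_continuity, HYd.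
  - lra.
  - apply Hinc; lra.
  - right. rewrite (proj2 (Hper t0)). apply HY0, Ht0.
  - assert (HYp : forall t, t0 < t < t1 -> 0 < Y t).
    { intros t Ht. destruct (Rlt_or_le t a); [apply Hinc|apply HYa]; lra. }
    assert (HYn : forall t, t0 <= t <= t1 -> 0 <= Y t).
    { intros t Ht. destruct (Req_dec t t0) as [->|]; [right; symmetry; apply HY0, Ht0|].
      destruct (Req_dec t t1) as [->|]; [lra|]. left. apply HYp. lra. }
    assert (HXm : forall s t, t0 <= s -> s <= t -> t <= t1 -> X s <= X t).
    { intros s t H1 H2 H3. apply (derive_nonneg_le X Y); auto.
      intros u Hu. apply HYn. lra. }
    (* Where the arch ends, [Y = 0] and [Y' <= 0], and there [Y' = - X]. *)
    assert (HX1 : 0 <= X t1).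
    { assert (H := derive_at_first_zero Y a t1 _ (proj1 Ht1) (HYd t1) HYt1 HYa).
      rewrite HYt1 in H. lra. }
    assert (Hi : 0 < / m ^ 2 <= 10 / 27).
    { split; [apply Rinv_0_lt_compat; lra|].
      replace (10 / 27) with (/ (27 / 10)) by field. apply Rinv_le_contravar; lra. }
    destruct (first_passage X Y t0 t1 (-1 - 31 / 50 * / m ^ 2)) as [sa [Hsa HXa]];
      auto; try lra.
    destruct (first_passage X Y sa t1 (-1)) as [sb [Hsb HXb]]; auto; try lra.
    destruct (first_passage X Y sb t1 (-1 + 11 / 5 * / m ^ 2)) as [sc [Hsc HXc]];
      auto; try lra.
    destruct (first_passage X Y sc t1 0) as [sd [Hsd HXd0]]; auto; try lra.
    assert (Hsa1 : sa < t1).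
    { destruct (proj2 Hsa) as [|He]; [assumption|]. rewrite He in HXa. lra. }
    assert (Hsb1 : sb < t1).
    { destruct (proj2 Hsb) as [|He]; [assumption|]. rewrite He in HXb. lra. }
    assert (Hsc1 : sc < t1).
    { destruct (proj2 Hsc) as [|He]; [assumption|]. rewrite He in HXc. lra. }
    assert (Hb : 31 / 40 < m * Y sb).
    { enough (0 < m * Y sb - 5 / 4 * (31 / 50 + m ^ 2 * (1 + X sb)))
        by (rewrite HXb in H; lra).
      apply (strict_barrier
        (fun t => m * Y t - 5 / 4 * (31 / 50 + m ^ 2 * (1 + X t)))
        (fun t => m * (- X t - mu * (l * X t ^ 2 - 1) * Y t) - 5 / 4 * m ^ 2 * Y t)
        sa sb); [| | |lra].
      - intros t _. auto_derive; [repeat split; eexists; eauto|].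
        rewrite (is_derive_unique (fun x : R => Y x : R) _ _ (HYd t)),
          (is_derive_unique (fun x : R => X x : R) _ _ (HXd t)). ring.
      - rewrite HXa.
        replace (31 / 50 + m ^ 2 * (1 + (-1 - 31 / 50 * / m ^ 2))) with 0 by (field; lra).
        assert (0 < m * Y sa) by (apply Rmult_lt_0_compat; [|apply HYp]; lra). lra.
      - intros t Ht Hf.
        assert (H1 := HXm sa t ltac:(lra) ltac:(lra) ltac:(lra)).
        assert (H2 := HXm t sb ltac:(lra) ltac:(lra) ltac:(lra)).
        rewrite HXa in H1. rewrite HXb in H2.
        assert (HYt := HYp t ltac:(lra)).
        set (i := / m ^ 2) in *. set (e := m ^ 2 * (-1 - X t)).
        assert (HXe : X t = -1 - e * i) by (unfold e, i; field; lra).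
        assert (He : 0 <= e <= 31 / 50).
        { split; [apply Rmult_le_pos; nra|].
          apply Rmult_le_reg_r with i; [lra|]. lra. }
        assert (Hea := early_barrier i e ltac:(lra) He).
        set (f := 5 / 4 * (31 / 50 - e)) in *.
        assert (HYf : Y t = f / m).
        { apply Rmult_eq_reg_l with m; [|lra].
          replace (m * (f / m)) with f by (field; lra). unfold f, e. lra. }
        (* Replacing [l] by 1 only lowers [Y'] while [Y > 0]. *)
        assert (Hcmp : 0 <= mu * ((1 - l) * X t ^ 2) * Y t).
        { apply Rmult_le_pos; [|lra]. apply Rmult_le_pos; [lra|].
          apply Rmult_le_pos; [lra|apply pow2_ge_0]. }
        assert (Hmain : 0 < m * (- X t - mu * (X t ^ 2 - 1) * Y t) - 5 / 4 * m ^ 2 * Y t).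
        { replace (m * (- X t - mu * (X t ^ 2 - 1) * Y t) - 5 / 4 * m ^ 2 * Y t)
            with (m * (1 + e * i - f * (2 * e + e ^ 2 * i + 5 / 4))).
          - apply Rmult_lt_0_compat; lra.
          - rewrite HXe, HYf, <- Hm3. unfold i. field. lra. }
        nra. }
    (* The cubic is the primitive of [1 - X ^ 2] that vanishes at 2; its double zero at -1 gives
       [J = Y] there. *)
    set (J := fun t => Y t - mu * ((1 + X t) ^ 2 * (2 - X t) / 3)).
    set (J' := fun t => - X t + mu * (1 - l) * X t ^ 2 * Y t).
    assert (HJd : forall t, is_derive J t (J' t)).
    { intros t. unfold J, J'. auto_derive; [repeat split; eexists; eauto|].
      rewrite (is_derive_unique (fun x : R => Y x : R) _ _ (HYd t)),
        (is_derive_unique (fun x : R => X x : R) _ _ (HXd t)). field. }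
    assert (HJ' : forall t, t0 <= t <= t1 -> - X t <= J' t).
    { intros t Ht. unfold J'.
      assert (0 <= mu * (1 - l) * X t ^ 2 * Y t); [|lra].
      apply Rmult_le_pos; [|apply HYn, Ht].
      apply Rmult_le_pos; [apply Rmult_le_pos; lra|apply pow2_ge_0]. }
    assert (Hc : 287 / 200 < m * J sc).
    (* [sf] falls from 1 at [sb] to 0 at [sc]; the barrier [287 / 200 - 33 / 50 * sf ^ 3] starts at
       exactly 31/40. *)
    { set (sf := fun t => 1 - 5 / 11 * m ^ 2 * (1 + X t)).
      enough (0 < m * J sc - (287 / 200 - 33 / 50 * sf sc ^ 3)).
      { assert (Hs0 : sf sc = 0) by (unfold sf; rewrite HXc; field; lra).
        rewrite Hs0 in H. lra. }
      apply (strict_barrier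
        (fun t => m * J t - (287 / 200 - 33 / 50 * sf t ^ 3))
        (fun t => m * J' t - 9 / 10 * sf t ^ 2 * m ^ 2 * Y t) sb sc); [| | |lra].
      - intros t _. unfold sf. auto_derive; [repeat split; eexists; eauto|].
        rewrite (is_derive_unique (fun x : R => J x : R) _ _ (HJd t)),
          (is_derive_unique (fun x : R => X x : R) _ _ (HXd t)). field.
      - unfold J, sf. rewrite HXb. lra.
      - intros t Ht Hf.
        assert (H1 := HXm sb t ltac:(lra) ltac:(lra) ltac:(lra)).
        assert (H2 := HXm t sc ltac:(lra) ltac:(lra) ltac:(lra)).
        rewrite HXb in H1. rewrite HXc in H2.
        assert (HJt := HJ' t ltac:(lra)).
        set (i := / m ^ 2) in *.
        assert (Hmi : m ^ 2 * i = 1) by (unfold i; field; lra).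
        assert (Hs : 0 <= sf t <= 1) by (unfold sf; split; nra).
        assert (Hmid := middle_barrier i (sf t) ltac:(lra) Hs).
        set (s := sf t) in *. cbv zeta in Hmid.
        set (x := 11 / 5 * (1 - s)) in *.
        assert (HXx : X t = -1 + x * i).
        { unfold x, s, sf. replace (-1 + 11 / 5 * (1 - (1 - 5 / 11 * m ^ 2 * (1 +
        X t))) * i)
            with (-1 + (m ^ 2 * i) * (1 + X t)) by field. rewrite Hmi. ring. }
        assert (HYx : Y t = (x ^ 2 - x ^ 3 * i / 3 + (287 / 200 - 33 / 50 * s ^ 3)) / m).
        { apply Rmult_eq_reg_l with m; [|lra].
          replace (m * Y t) with (m * J t + m * (mu * ((1 + X t) ^ 2 * (2 - X t) / 3)))
            by (unfold J; ring).
          replace (m * J t) with (287 / 200 - 33 / 50 * s ^ 3) by lra.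
          rewrite HXx, <- Hm3. unfold i. field. lra. }
        apply Rlt_le_trans with (m * - X t - 9 / 10 * s ^ 2 * m ^ 2 * Y t); [|nra].
        replace (m * - X t - 9 / 10 * s ^ 2 * m ^ 2 * Y t) with
          (m * (1 - x * i - 9 / 10 * s ^ 2 *
             (x ^ 2 - x ^ 3 * i / 3 + (287 / 200 - 33 / 50 * s ^ 3)))).
        + apply Rmult_lt_0_compat; lra.
        + rewrite HYx, HXx. field. lra. }
    assert (Hd : 287 / 200 < m * J sd).
    { assert (J sc <= J sd); [|nra].
      apply (derive_nonneg_le J J'); [lra|auto|].
      intros t Ht. assert (H1 := HXm t sd ltac:(lra) ltac:(lra) ltac:(lra)).
      assert (HJt := HJ' t ltac:(lra)). lra. }
    (* The shift by 3/100 makes the last barrier strict and still leaves [k sd > 7 / 5]. *)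
    set (k := fun t => m * J t - 3 / 100).
    assert (Hkd : forall t, is_derive k t (m * J' t)).
    { intros t. unfold k. auto_derive; [eexists; apply HJd|].
      rewrite (is_derive_unique (fun x : R => J x : R) _ _ (HJd t)). ring. }
    destruct (first_zero k sd t1) as [t2 [Ht2 [Hk2 Hkp]]].
    + intros t _. eapply is_derive_continuity, Hkd.
    + lra.
    + unfold k. lra.
    + unfold k, J. rewrite HYt1.
      assert (HXt1 := HX t1).
      assert (0 <= m * (mu * ((1 + X t1) ^ 2 * (2 - X t1) / 3))); [|lra].
      apply Rmult_le_pos; [lra|]. apply Rmult_le_pos; [lra|].
      apply Rmult_le_pos; [|lra]. apply Rmult_le_pos; [apply pow2_ge_0|lra].
    + assert (Hfin : 0 < layer (k t2) - (2 - X t2)).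
      { apply (strict_barrier
          (fun t => layer (k t) - (2 - X t))
          (fun t => layer' (k t) * (m * J' t) + Y t) sd t2); [| | |lra].
        - intros t _. unfold layer, layer'. auto_derive; [repeat split; eexists; eauto|].
          rewrite (is_derive_unique (fun x : R => k x : R) _ _ (Hkd t)),
            (is_derive_unique (fun x : R => X x : R) _ _ (HXd t)). field.
        - rewrite HXd0.
          assert (2 < layer (k sd)) by (apply layer_bound; unfold k; lra). lra.
        - intros t Ht Hf.
          assert (Hk : 0 <= k t).
          { destruct (Req_dec t t2) as [->|]; [lra|]. left; apply Hkp; lra. }
          assert (H1 := HXm sd t ltac:(lra) ltac:(lra) ltac:(lra)).
          rewrite HXd0 in H1.
          assert (HJt := HJ' t ltac:(lra)).
          assert (Hl0 := layer'_nonneg (k t) Hk).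
          assert (Hlate := late_barrier (m ^ 2) (k t) HM Hk ltac:(lra)).
          assert (HXl : X t = 2 - layer (k t)) by lra.
          assert (HYk : m * Y t = (m ^ 2) ^ 2 * (layer (k t) * (3 - layer (k t)) ^ 2 / 3)
                                  + k t + 3 / 100).
          { replace (m * Y t) with (k t + 3 / 100 + m * (mu * ((1 +
          X t) ^ 2 * (2 - X t) / 3)))
              by (unfold k, J; ring).
            rewrite HXl, <- Hm3. field. }
          apply Rlt_le_trans with (layer' (k t) * (m * - X t) + Y t).
          + apply Rmult_lt_reg_l with m; [exact Hm|]. rewrite Rmult_0_r.
            replace (m * (layer' (k t) * (m * - X t) + Y t))
              with (m * Y t - m ^ 2 * (X t * layer' (k t))) by ring.
            rewrite HYk, HXl. lra.
          + apply Rplus_le_compat_r, Rmult_le_compat_l; [exact Hl0|].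
            apply Rmult_le_compat_l; lra. }
      rewrite Hk2 in Hfin. unfold layer in Hfin. assert (HXt2 := HX t2). lra.
Qed.

(** * Attained amplitude and reduction to the strip *)

Lemma periodic_shift (f : R -> R) (T : R) :
  (forall t, f (t + T) = f t) -> forall (z : Z) t, f (t + IZR z * T) = f t.
Proof.
  intros Hf z. induction z as [|z IH|z IH] using Z.peano_ind; intros t.
  - f_equal. ring.
  - rewrite succ_IZR. replace (t + (IZR z + 1) * T) with (t + IZR z * T + T) by ring.
    rewrite Hf. apply IH.
  - rewrite <- (Hf (t + IZR (Z.pred z) * T)).
    unfold Z.pred. rewrite plus_IZR.
    replace (t + (IZR z + -1) * T + T) with (t + IZR z * T) by ring. apply IH.
Qed.

Lemma periodic_attains_max (f : R -> R) (T : R) :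
  0 < T -> (forall t, f (t + T) = f t) -> (forall t, continuity_pt f t) ->
  exists s, forall t, f t <= f s.
Proof.
  intros HT Hf Hc.
  destruct (continuity_ab_maj f 0 T) as [s [Hs _]]; [lra|auto|].
  exists s. intros t.
  (* [up] is strictly above its argument by at most 1, so this shift moves [t] into [[0, T)]. *)
  rewrite <- (periodic_shift f T Hf (1 - up (t / T))).
  apply Hs. destruct (archimed (t / T)) as [H1 H2].
  rewrite minus_IZR.
  assert (Ht : t = t / T * T) by (field; lra).
  split; rewrite Ht at 1; nra.
Qed.

Theorem theorem1p1 (mu : R) (Hmu : 0 < mu) (Gamma : R * R -> Prop)
  (HGamma : limit_cycle mu Gamma) :
  exists A : R, is_amplitude Gamma A /\ A > 2.
Proof.
  destruct HGamma as [x [y [Hsol [[T [HT Hper]] [Hnc Horb]]]]].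
  assert (Hx : forall t, is_derive x t (y t)) by (intros t; apply Hsol).
  assert (Hy : forall t, is_derive y t (- x t - mu * (x t ^ 2 - 1) * y t))
    by (intros t; apply Hsol).
  destruct (periodic_attains_max (fun t => Rabs (x t)) T HT) as [s Hs].
  { intros t. rewrite (proj1 (Hper t)). reflexivity. }
  { intros t. apply (continuity_pt_comp x Rabs).
    - eapply is_derive_continuity, Hx.
    - apply Rcontinuity_abs. }
  exists (Rabs (x s)). split.
  { split.
    - exists (x s, y s). split; [apply Horb; exists s|]; reflexivity.
    - intros p Hp. apply Horb in Hp. destruct Hp as [t ->]. apply Hs. }
  destruct (Rle_or_lt (Rabs (x s)) 2) as [HA|]; [exfalso|lra].
  (* Zero amplitude would make the trajectory constant. *)
  assert (HA0 : 0 < Rabs (x s)).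
  { destruct (Rabs_pos (x s)) as [|H0]; [assumption|exfalso].
    rewrite <- H0 in Hs.
    assert (Hx0 : forall t, x t = 0).
    { intros t. specialize (Hs t). generalize (Rabs_pos (x t)).
      intros Hp. destruct (Req_dec (x t) 0) as [|Hn]; [assumption|].
      generalize (Rabs_pos_lt (x t) Hn). lra. }
    assert (Hy0 : forall t, y t = 0).
    { intros t. apply (derive_at_max x t); auto. intros u. rewrite !Hx0. lra. }
    destruct Hnc as [u [v Huv]]. apply Huv. rewrite !Hx0, !Hy0. reflexivity. }
  assert (Hxs : x s <> 0) by (intros H; rewrite H, Rabs_R0 in HA0; lra).
  (* The sign of [c] performs the reflection: the scaled orbit is at -2 at time [s] whatever the
     sign of [x s]. *)
  set (c := -2 / x s).
  set (l := x s ^ 2 / 4).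
  assert (Hl : l <= 1).
  { unfold l. rewrite <- pow2_abs. nra. }
  assert (Hscaled : scaled_vdp mu l (fun t => c * x t) (fun t => c * y t)).
  { intros t. split.
    - auto_derive; [eexists; apply Hx|].
      rewrite (is_derive_unique (fun t : R => x t : R) _ _ (Hx t)). ring.
    - auto_derive; [eexists; apply Hy|].
      rewrite (is_derive_unique (fun t : R => y t : R) _ _ (Hy t)).
      unfold l, c. field. exact Hxs. }
  assert (Hbound : forall t, -2 <= c * x t <= 2).
  { intros t. apply Rabs_le_between. unfold c.
    rewrite Rabs_mult, Rabs_div by exact Hxs. rewrite (Rabs_left (-2)) by lra.
    apply Rmult_le_reg_r with (Rabs (x s)); [exact HA0|].
    replace (- -2 / Rabs (x s) * Rabs (x t) * Rabs (x s)) with (2 * Rabs (x t))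
      by (field; lra).
    specialize (Hs t). lra. }
  assert (Hstart : c * x s = -2) by (unfold c; field; exact Hxs).
  assert (Hper' : forall t, c * x (t + T) = c * x t /\ c * y (t + T) = c * y t).
  { intros t. destruct (Hper t) as [-> ->]. split; reflexivity. }
  destruct (Rle_or_lt mu (9 / 2)) as [Hs'|Hl'].
  - exact (no_orbit_in_strip_small_mu mu l T s _ _
      (conj Hmu Hs') Hl HT Hscaled Hper' Hbound Hstart).
  - exact (no_orbit_in_strip_large_mu mu l T s _ _
      (Rlt_le _ _ Hl') Hl HT Hscaled Hper' Hbound Hstart).
Qed.
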